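(* Let $(X,\boldsymbol{f})$ be a topological non-autonomous iterated function system on a compact metric space $(X,d)$ and let $\varphi\in C(X,\mathbb{R})$. If $Z\subset X$ is a non-empty compact set, then $$P_{Z}(\boldsymbol{f},\varphi)=\sup\left\{\underline{P}_{\mu}(\boldsymbol{f},\varphi):\ \mu\in M(X),\ \mu(Z)=1\right\}.$$
   Context: A topological non-autonomous iterated function system (NAIFS) $(X,\boldsymbol{f})$ on a compact metric space $(X,d)$ is a sequence $\boldsymbol{f}=\{\boldsymbol{f}^{(j)}\}_{j\ge1}$ of collections $\boldsymbol{f}^{(j)}=\{f_i^{(j)}:X\to X\}_{i\in I^{(j)}}$ of continuous maps, each $I^{(j)}$ being a non-empty finite index set. Here $\mathbb{N}=\{1,2,\dots\}$. For $n\in\mathbb{N}$ put $I^{1,n}=\prod_{j=1}^{n}I^{(j)}$, and for a word $w=w_1\cdots w_n\in I^{1,n}$ and $1\le k\le n$ put $f_w^{1,k}=f^{(k)}_{w_k}\circ\cdots\circ f^{(1)}_{w_1}$, $f_w^{1,0}=\mathrm{id}_X$. Define the metric $d_n(x,y)=\max_{w\in I^{1,n}}\max_{0\le t\le n}d(f_w^{1,t}(x),f_w^{1,t}(y))$ and the Bowen ball $B_n(x,\delta)=\{y\in X:d_n(x,y)<\delta\}$. For $\varphi\in C(X,\mathbb{R})$ (continuous real-valued functions on $X$) and $w\in I^{1,n}$ put $S_w\varphi(x)=\sum_{i=0}^{n-1}\varphi(f_w^{1,i}(x))$ and $S_n\varphi(x)=\max_{w\in I^{1,n}}S_w\varphi(x)$.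 Pesin--Pitskel topological pressure: for $Z\subset X$, $\alpha\in\mathbb{R}$, $\delta>0$, $N\in\mathbb{N}$ let $$M(Z,\boldsymbol{f},\varphi,\alpha,\delta,N)=\inf\Big\{\sum_i\exp\big(-\alpha n_i+S_{n_i}\varphi(x_i)\big)\Big\},$$ the infimum being over all finite or countable families $\{B_{n_i}(x_i,\delta)\}_i$ with $x_i\in X$, $n_i\ge N$ and $Z\subset\bigcup_iB_{n_i}(x_i,\delta)$. This is non-decreasing in $N$; put $m(Z,\boldsymbol{f},\varphi,\alpha,\delta)=\lim_{N\to\infty}M(Z,\boldsymbol{f},\varphi,\alpha,\delta,N)$. Let $$P_Z(\boldsymbol{f},\varphi,\delta)=\inf\{\alpha: m(Z,\boldsymbol{f},\varphi,\alpha,\delta)=0\}=\sup\{\alpha: m(Z,\boldsymbol{f},\varphi,\alpha,\delta)=\infty\}$$ (with $\inf\varnothing=+\infty$, $\sup\varnothing=-\infty$), and $P_Z(\boldsymbol{f},\varphi)=\lim_{\delta\to0}P_Z(\boldsymbol{f},\varphi,\delta)$, which exists in $[-\infty,+\infty]$ by monotonicity in $\delta$. Measure-theoretic pressure: $M(X)$ is the set of all Borel probability measures on $X$. For $\mu\in M(X)$ and $x\in X$, $$\underline{P}_{\mu}(\boldsymbol{f},\varphi,x)=\lim_{r\to0}\liminf_{n\to\infty}\frac{-\log\mu(B_n(x,r))+S_n\varphi(x)}{n}$$ (with $-\log 0=+\infty$), and $\underline{P}_{\mu}(\boldsymbol{f},\varphi)=\int\underline{P}_{\mu}(\boldsymbol{f},\varphi,x)\,d\mu(x)\in(-\infty,+\infty]$.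 *)

(* Defs.v *)
From HB Require Import structures.
From mathcomp Require Import all_boot all_order all_algebra.
From mathcomp Require Import all_classical all_reals all_analysis.

Set Implicit Arguments.
Unset Strict Implicit.
Unset Printing Implicit Defensive.

Import Order.TTheory GRing.Theory Num.Theory.
Import numFieldNormedType.Exports.

Local Open Scope classical_set_scope.
Local Open Scope ring_scope.

(* The base point is only there because measurable types are pointed: a metric
   space admits one as soon as it is non-empty. *)
#[short(type="pointedMetricType")]
HB.structure Definition PointedMetric (R : numDomainType) :=
  {T of Pointed T & Metric R T}.

(* Stages are numbered from 0: stage [j] here is the collection f^(j+1). *)
Record naifs (X : topologicalType) := Naifs {
  alphabet : nat -> finType ;
  alphabet_gt0 : forall j, (0 < #|alphabet j|)%N ;
  stage_map : forall j, alphabet j -> X -> X ;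
  stage_map_continuous : forall j (i : alphabet j), continuous (stage_map i)
}.

Arguments stage_map {X} _ {j}.

Definition word (X : topologicalType) (f : naifs X) (n : nat) : finType :=
  {dffun forall j : 'I_n, alphabet f j}.

(* f_w^{1,k}, meaningful for k <= n; past the end of the word the orbit is
   left where it is. *)
Fixpoint branch (X : topologicalType) (f : naifs X) (n : nat) (w : word f n)
    (k : nat) (x : X) : X :=
  if k is k'.+1 then
    if insub k' is Some j then stage_map f (w j) (branch w k' x)
    else branch w k' x
  else x.

Section topological_pressure.
Context {R : realType} {X : metricType R}.
Implicit Types (f : naifs X) (phi : X -> R) (Z : set X).

(* The seed 0 does not affect the maxima, distances being non-negative. *)
Definition bowen_dist f (n : nat) (x y : X) : R :=
  \big[Order.max/0]_(w : word f n) \big[Order.max/0]_(t < n.+1)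
    mdist (branch w t x) (branch w t y).

Definition bowen_ball f (n : nat) (x : X) (delta : R) : set X :=
  [set y | bowen_dist f n x y < delta].

Definition word_sum f phi (n : nat) (w : word f n) (x : X) : R :=
  \sum_(i < n) phi (branch w i x).

(* A maximum: the set of words of length n is finite and non-empty. *)
Definition max_sum f phi (n : nat) (x : X) : R :=
  sup [set word_sum phi w x | w in [set: word f n]].

(* Finite or countable families of Bowen balls are indexed by subsets of nat. *)
Definition cover_sum Z f phi (alpha delta : R) (N : nat) : \bar R :=
  ereal_inf [set s | exists (D : set nat) (n : nat -> nat) (x : nat -> X),
    [/\ forall i, D i -> (N <= n i)%N,
        Z `<=` \bigcup_(i in D) bowen_ball f (n i) (x i) delta &
        s = (\esum_(i in D)
          (expR (- alpha * (n i)%:R + max_sum f phi (n i) (x i)))%:E)%E]].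

Definition cover_outer Z f phi (alpha delta : R) : \bar R :=
  limn (cover_sum Z f phi alpha delta).

Definition pressure_at_scale Z f phi (delta : R) : \bar R :=
  ereal_inf [set alpha%:E |
    alpha in [set alpha : R | cover_outer Z f phi alpha delta = 0%E]].

Definition pressure Z f phi : \bar R :=
  lim (pressure_at_scale Z f phi delta @[delta --> 0^'+]).

End topological_pressure.

Notation borel X := (g_sigma_algebraType (@open X)).

Section measure_pressure.
Context {R : realType} {X : pointedMetricType R}.
Implicit Types (f : naifs X) (phi : X -> R) (mu : probability (borel X) R).

(* [lne 0 = -oo], so a null ball contributes +oo; the term n = 0 does not
   affect the lower limit. *)
Definition lower_local_pressure mu f phi (x : X) : \bar R :=
  lim (limn_einf (fun n : nat =>
    (- lne (mu (bowen_ball f n x r)) + (max_sum f phi n x)%:E)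
      * (n%:R^-1)%:E)%E @[r --> 0^'+]).

Definition lower_measure_pressure mu f phi : \bar R :=
  (\int[mu]_x lower_local_pressure mu f phi x)%E.

End measure_pressure.

(* Main.v *)
From HB Require Import structures.
Require Import Defs.
From mathcomp Require Import all_boot all_order all_algebra.
From mathcomp Require Import all_classical all_reals all_analysis.
From mathcomp Require Import measurable_realfun ring lra.

(** Both inequalities compare the cost of covering [Z] by Bowen balls with the
    mass that a measure carried by [Z] gives to these balls.

    A measure bounds covers from below ([mass_distribution]). If [-log
    mu(B_n(x,r)) + S_n phi(x) >= s n] for all [x] in [A] and [n >= N], then a
    ball [B_n(y,r/2)] meeting [A] lies in some [B_n(x,r)] with [x] in [A], so
    its mass is at most [exp(- s n + S_n phi(x))], where [x] may be replaced by
    [y] at the price of [exp(e n)], by uniform continuity of [phi]. Summing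
    over a cover, [mu A] is at most its cost. Hence no set on which the local
    pressure exceeds a number larger than the pressure of [Z] has positive
    measure ([lower_local_pressure_le_ae]), and integrating gives one
    inequality.

    For the other one, let [s] be smaller than the pressure of [Z]; a
    probability with [mu(B_n(x,d)) <= C exp(- s n + S_n phi(x))] for all [x]
    and all large [n] has local pressure at least [s] everywhere. It is found
    by duality ([frostman]). For a function [g] with finitely many values, let
    [p g] be the least cost of a finite family of Bowen balls with nonnegative
    weights whose weighted indicators add up to at least [g] on [Z]. The
    functional [p] is sublinear, and an additive [L <= p] with [L 1 = p 1]
    ([hahn_banach]) is automatically positive, vanishes off [Z], and gives
    every ball at most its weight. Thus [A |-> L(1_A) / p 1] is a finitely
    additive probability defined on all subsets. On a compact space it can be
    regularised into a Borel probability which does not exceed it on open sets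
    ([content_regularization]), and Bowen balls are open.

    What has to be checked is [p 1 > 0]: weighted covers must not be much
    cheaper than genuine ones ([cover_sum_le_cost]). Given a weighted cover,
    each point of [Z] receives a mass of at least [exp(- e n)] from the balls
    of some level [n], because these thresholds add up to less than 1. At a
    fixed level all the balls are balls of one metric, so a maximal separated
    set of such points covers them all at twice the radius; the balls of radius
    [d] around its points being disjoint, each of its points can be charged to
    balls of its own, and [greedy_cover] does this by a plain induction. *)

Set Implicit Arguments.
Unset Strict Implicit.
Unset Printing Implicit Defensive.

Import Order.TTheory GRing.Theory Num.Theory.
Import numFieldNormedType.Exports.

Local Open Scope classical_set_scope.
Local Open Scope ring_scope.

(** * A Hahn-Banach theorem in abelian groups *)

Section hahn_banach.
Context {R : realType} {V : zmodType}.
Implicit Types (p q : V -> R) (x y : V).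

(** Natural multiples are the only scalars available in an abelian group; the
    reverse of the second inequality follows from the first one. *)
Definition sublinear q :=
  (forall x y, q (x + y) <= q x + q y) /\
  (forall x n, q x *+ n <= q (x *+ n)).

Lemma sublinear0 q : sublinear q -> q 0 = 0.
Proof.
move=> [_ qM]; apply/eqP; rewrite eq_le.
have := qM 0 0; have := qM 0 2; rewrite !mul0rn mulr0n mulr2n; lra.
Qed.

Lemma sublinearMn q x n : sublinear q -> q (x *+ n) = q x *+ n.
Proof.
move=> sq; apply/eqP; rewrite eq_le sq.2 andbT.
elim: n => [|n ih]; first by rewrite !mulr0n sublinear0.
by rewrite !mulrS (le_trans (sq.1 _ _))// lerD2l.
Qed.

Lemma sublinear_ge q x : sublinear q -> - q (- x) <= q x.
Proof.
move=> sq; have := sq.1 x (- x); rewrite subrr sublinear0//; lra.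
Qed.

Lemma le_inf_image (T : Type) (A : set T) (u : T -> R) (c : R) :
  A !=set0 -> (forall a, A a -> c <= u a) -> c <= inf [set u a | a in A].
Proof.
move=> [a Aa] cu; apply: lb_le_inf; first by exists (u a), a.
by move=> _ [b Ab <-]; exact: cu.
Qed.

Lemma inf_image_le (T : Type) (A : set T) (u : T -> R) (c : R) a :
  (forall a, A a -> c <= u a) -> A a -> inf [set u a | a in A] <= u a.
Proof.
move=> cu Aa; apply: ge_inf; last by exists a.
by exists c => _ [b Ab <-]; exact: cu.
Qed.

Lemma le_add_inf_image (T S : Type) (A : set T) (B : set S)
    (u : T -> R) (v : S -> R) (c : R) : A !=set0 -> B !=set0 ->
  (forall a b, A a -> B b -> c <= u a + v b) ->
  c <= inf [set u a | a in A] + inf [set v b | b in B].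
Proof.
move=> A0 B0 cuv; rewrite -lerBlDr; apply: le_inf_image => // a Aa.
rewrite lerBlDr -lerBlDl; apply: le_inf_image => // b Bb.
by rewrite lerBlDl; exact: cuv.
Qed.

(** The functional [q' x = inf_n (q (x + n y) - n q y)] pushes [q] down towards
    additivity in the direction [y]. The terms decrease with [n], so the
    infimum is a limit, which is what keeps it homogeneous. *)
Lemma sublinear_shift q y : sublinear q -> exists q',
  [/\ sublinear q', forall x, q' x <= q x & forall x, q' x <= q (x + y) - q y].
Proof.
move=> sq; pose u x n := q (x + y *+ n) - q y *+ n.
pose q' x := inf [set u x n | n in [set: nat]].
have T0 : [set: nat] !=set0 by exists 0%N.
have u_ge x n : setT n -> - q (- x) <= u x n.
  move=> _; rewrite /u; have := sq.1 (x + y *+ n) (- x).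
  rewrite addrAC subrr add0r sublinearMn//; lra.
have q'_le x n : q' x <= u x n by exact: inf_image_le (u_ge x) _.
have uS x n m : u x (n + m)%N <= u x n.
  rewrite /u !mulrnDr addrA.
  have := sq.1 (x + y *+ n) (y *+ m); rewrite [q (y *+ m)]sublinearMn//; lra.
exists q'; split.
- split=> [a b|a n].
    apply: le_add_inf_image => // n m _ _.
    apply: le_trans (q'_le _ (n + m)%N) _; rewrite /u !mulrnDr.
    have := sq.1 (a + y *+ n) (b + y *+ m); rewrite addrACA; lra.
  apply: le_inf_image => // m _; case: n => [|n].
    by rewrite !mulr0n (le_trans _ (u_ge _ _ _))// oppr0 sublinear0 ?oppr0.
  apply: le_trans (_ : u a m *+ n.+1 <= _); first by rewrite lerMn2r q'_le.
  rewrite {1}/u mulrnBl -(sublinearMn (a + _))// mulrnDl -!mulrnA mulnS.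
  exact: uS.
- by move=> x; apply: le_trans (q'_le x 0%N) _; rewrite /u !mulr0n addr0 subr0.
- by move=> x; exact: q'_le x 1%N.
Qed.

(** Zorn's lemma: the pointwise infimum of a chain of sublinear functionals
    below [p] is finite because each of them is at least [- p (- x)] at [x]. *)
Lemma sublinear_minimal p : sublinear p -> exists q,
  [/\ sublinear q, forall x, q x <= p x &
      forall q', sublinear q' -> (forall x, q' x <= q x) -> q' = q].
Proof.
move=> sp; pose T := {q | sublinear q /\ forall x, q x <= p x}.
pose p0 : T := exist _ p (conj sp (fun x => lexx (p x))).
pose r (a b : T) := `[< forall x, sval b x <= sval a x >].
have [| | |t tmin] := @ZL_preorder T p0 r.
- by move=> t; apply/asboolP.
- move=> a b c /asboolP ab /asboolP bc; apply/asboolP => x.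
  exact: le_trans (bc x) (ab x).
- move=> A Atot; have [A0|/set0P/negP] := pselect (A !=set0); last first.
    by move/negPn/eqP => ->; exists p0.
  pose q x := inf [set sval a x | a in A].
  have lb x (a : T) : A a -> - p (- x) <= sval a x.
    move=> _; case: a => a [sa ap] /=.
    by rewrite (le_trans _ (sublinear_ge _ sa))// lerN2.
  have q_le x a : A a -> q x <= sval a x by exact: inf_image_le (lb x).
  have sq : sublinear q.
    split=> [x y|x n].
      apply: le_add_inf_image => // a b Aa Ab.
      have [c [Ac ca cb]] : exists c, [/\ A c,
          forall z, sval c z <= sval a z & forall z, sval c z <= sval b z].
        by case: (Atot _ _ Aa Ab) => /asboolP ab; [exists b|exists a].
      apply: le_trans (q_le _ _ Ac) _; apply: le_trans ((svalP c).1.1 _ _) _.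
      by rewrite lerD.
    apply: le_inf_image => // a Aa.
    by rewrite sublinearMn ?lerMn2r ?q_le ?orbT//; case: (svalP a).
  have qp x : q x <= p x.
    by case: A0 => a Aa; exact: le_trans (q_le _ _ Aa) ((svalP a).2 x).
  exists (exist _ q (conj sq qp)) => a Aa; apply/asboolP => x; exact: q_le.
- case: t tmin => q [sq qp] tmin; exists q; split => // q' sq' q'q.
  have q'p x : q' x <= p x by exact: le_trans (qp x).
  have /asboolP/= qq' :=
    tmin (exist _ q' (conj sq' q'p)) (introT (asboolP _) q'q).
  by apply/funext => x; apply/eqP; rewrite eq_le q'q qq'.
Qed.

(** A minimal sublinear functional is additive, as it cannot decrease when
    shifted along any [y]. Shifting [p] along [x0] before minimising forces [L
    (- x0) <= - p x0], which pins down the value at [x0]. *)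
Theorem hahn_banach p x0 : sublinear p -> exists L : V -> R,
  [/\ {morph L : x y / x + y}, forall x, L x <= p x & L x0 = p x0].
Proof.
move=> sp; have [p' [sp' p'p p'x0]] := sublinear_shift x0 sp.
have [L [sL Lp' Lmin]] := sublinear_minimal sp'.
have LD : {morph L : x y / x + y}.
  move=> x y; apply/eqP; rewrite eq_le sL.1 /=.
  have [q [sq qL qy]] := sublinear_shift y sL.
  by rewrite -lerBrDr -{1}(Lmin q sq qL) qy.
have Lp x : L x <= p x by exact: le_trans (Lp' x) (p'p x).
exists L; split => //; apply/eqP; rewrite eq_le Lp /=.
have := p'x0 (- x0); have := Lp' (- x0); have := LD x0 (- x0).
rewrite subrr addNr !sublinear0//; lra.
Qed.

End hahn_banach.

(** * From finitely additive set functions to Borel probabilities *)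

(** Caratheodory's theorem provides the measure: its measurable sets form a
    sigma algebra, which contains the Borel sets as soon as it contains the
    open ones. *)
Lemma caratheodory_borel {R : realType} {X : ptopologicalType}
    (om : {outer_measure set X -> \bar R}) :
  (forall U, open U -> om.-caratheodory U) -> om setT = 1%E ->
  exists mu : probability (borel X) R, forall A, mu A = om A.
Proof.
move=> omU om1.
have sub (A : set (borel X)) : measurable A -> om.-cara.-measurable A.
  apply: smallest_sub => //; exact: sigma_algebra_measurable.
have sa : semi_sigma_additive (om : set (borel X) -> \bar R).
  move=> F mF tF mUF;
    apply: (@caratheodory_measure_sigma_additive R X om) => //.
    by move=> i; exact: sub.
  exact: sub.
pose mI := isMeasure.Build _ (borel X) R (om : set (borel X) -> \bar R)
  (outer_measure0 om) (outer_measure_ge0 om) sa.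
pose m : {measure set (borel X) -> \bar R} :=
  HB.pack (om : set (borel X) -> \bar R) mI.
(* The total mass is already 1, so that normalising [m] does not change it. *)
exists (mnormalize m (dirac (point : borel X))) => A.
have m1 : m setT = 1%E by exact: om1.
suff : mnormalize m (dirac (point : borel X)) A = om A by [].
by rewrite /mnormalize m1 onee_eq0 /= invr1 mule1.
Qed.

Section regularization.
Context {R : realType} {X : pointedMetricType R}.
Implicit Types (A B K U V : set X) (e : R).

(** Erosions are closed, and by the Lebesgue number lemma every compact subset
    of an open [U] lies in one of them: they stand for the compact subsets of
    [U]. *)
Definition inner U e := [set x | ball x e `<=` U].

Lemma inner_sub U e : 0 < e -> inner U e `<=` U.
Proof. by move=> e0 x; apply; exact: ballxx. Qed.

Lemma innerS U V e : U `<=` V -> inner U e `<=` inner V e.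
Proof. by move=> UV x Ux; exact: subset_trans UV. Qed.

Lemma le_inner U e e' : e <= e' -> inner U e' `<=` inner U e.
Proof. by move=> ee' x; apply: subset_trans; exact: le_ball. Qed.

Lemma closed_inner U e : closed (inner U e).
Proof.
rewrite -openC openE => x /= /existsNP[y /not_implyP[xy Uy]].
rewrite ballEmdist /= in xy.
apply/nbhs_ballP; exists (e - mdist x y); first by rewrite /= subr_gt0.
move=> z; rewrite ballEmdist /= => xz; apply/existsNP; exists y.
apply/not_implyP; split => //; rewrite ballEmdist /=.
have := metric_triangle z x y; rewrite (metric_sym z x); lra.
Qed.


Variable L : set X -> R.
Hypothesis L_ge0 : forall A, 0 <= L A.
Hypothesis LT : L setT = 1.
Hypothesis LU : forall A B, A `&` B = set0 -> L (A `|` B) = L A + L B.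

Lemma content_le A B : A `<=` B -> L A <= L B.
Proof.
move=> AB; rewrite -(setDUK AB) LU ?lerDl ?L_ge0// setDE.
by rewrite setICA setICr setI0.
Qed.

Lemma content_le1 A : L A <= 1.
Proof. by rewrite -LT content_le. Qed.

Lemma content0 : L set0 = 0.
Proof. have := @LU set0 set0 (setI0 _); rewrite setU0; lra. Qed.

Lemma content_subadd A B : L (A `|` B) <= L A + L B.
Proof.
rewrite -(setDUK (@subsetUl _ A B)) LU ?setDIK//.
by rewrite lerD2l content_le// => x [[]].
Qed.

Lemma content_bigsubadd (F : nat -> set X) n :
  L (\big[setU/set0]_(i < n) F i) <= \sum_(i < n) L (F i).
Proof.
elim: n => [|n ih]; first by rewrite !big_ord0 content0.
by rewrite !big_ord_recr /= (le_trans (content_subadd _ _))// lerD2r.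
Qed.

(** A finitely additive [L] may give to an increasing union more than the limit
    of the masses. Counting only what compact subsets of [U] carry rules this
    out for open sets. *)
Definition inner_content U := sup [set L (inner U e) | e in [set e | 0 < e]].

Lemma le_inner_content U e : 0 < e -> L (inner U e) <= inner_content U.
Proof.
move=> e0; apply: ub_le_sup; last by exists e.
by exists 1 => _ [r _ <-]; exact: content_le1.
Qed.

Lemma inner_content_le U c :
  (forall e, 0 < e -> L (inner U e) <= c) -> inner_content U <= c.
Proof.
move=> Uc; apply: ge_sup; first by exists (L (inner U 1)), 1 => //=.
by move=> _ [e e0 <-]; exact: Uc.
Qed.

Lemma inner_content_ge0 U : 0 <= inner_content U.
Proof. exact: le_trans (L_ge0 _) (le_inner_content U (ltr01)). Qed.

Lemma inner_content_le_content U : inner_content U <= L U.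
Proof. by apply: inner_content_le => e e0; exact/content_le/(inner_sub e0). Qed.

Definition outer_content A :=
  inf [set inner_content U | U in [set U | open U /\ A `<=` U]].

Lemma outer_content_le A U :
  open U -> A `<=` U -> outer_content A <= inner_content U.
Proof.
move=> oU AU; apply: inf_image_le => //= V _; exact: inner_content_ge0.
Qed.

Lemma le_outer_content A c :
  (forall U, open U -> A `<=` U -> c <= inner_content U) ->
  c <= outer_content A.
Proof.
move=> Ac; apply: le_inf_image => [|U [oU AU]]; last exact: Ac.
by exists setT; split => //; exact: openT.
Qed.

Lemma outer_content_ge0 A : 0 <= outer_content A.
Proof. by apply: le_outer_content => U _ _; exact: inner_content_ge0. Qed.

Lemma outer_content0 : outer_content set0 = 0.
Proof.
apply/eqP; rewrite eq_le outer_content_ge0 andbT -content0.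
apply: le_trans (inner_content_le_content _).
by apply: outer_content_le => //; exact: open0.
Qed.

Lemma outer_contentT : outer_content setT = 1.
Proof.
apply/eqP; rewrite eq_le; apply/andP; split.
  apply: le_trans (content_le1 setT).
  apply: le_trans (inner_content_le_content _).
  by apply: outer_content_le => //; exact: openT.
apply: le_outer_content => U _ TU; rewrite -LT.
apply: le_trans (le_inner_content U ltr01).
by apply: content_le => x _ y _; exact: TU.
Qed.

Lemma outer_contentS A B : A `<=` B -> outer_content A <= outer_content B.
Proof.
move=> AB; apply: le_outer_content => U oU BU.
by apply: outer_content_le => //; exact: subset_trans BU.
Qed.

(** Once an erosion [K] of [V `&` U] has captured most of its mass, an erosion
    of the open set [V `\` K] captures that of [V `\` U]; the two are disjoint
    parts of one erosion of [V]. *)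
Lemma outer_content_split U V : open U -> open V ->
  outer_content (V `&` U) + outer_content (V `&` ~` U) <= inner_content V.
Proof.
move=> oU oV; rewrite -lerBrDr.
apply: le_trans (outer_content_le (openI oV oU) _) _ => //.
apply: inner_content_le => e e0; pose K := inner (V `&` U) e.
have oVK : open (V `&` ~` K) by
    apply: openI => //; apply: closed_openC; exact: closed_inner.
rewrite lerBrDr -lerBrDl.
apply: le_trans (outer_content_le oVK _) _.
  by move=> x [Vx Ux]; split => // /(inner_sub e0)[].
apply: inner_content_le => r r0; rewrite lerBrDl -LU; last first.
  rewrite -subset0 => x [Kx /(inner_sub r0)[_]]; exact.
have er0 : 0 < Num.min e r by rewrite lt_min e0.
apply: le_trans (le_inner_content V er0); apply: content_le => x [Kx|Kx].
  by apply: le_inner (innerS (@subIsetl _ V U) Kx); rewrite ge_min lexx.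
by apply: le_inner (innerS (@subIsetl _ V _) Kx); rewrite ge_min lexx orbT.
Qed.

Hypothesis cptX : compact [set: X].

(** Compactness is used with a single index [n] that controls both the number
    of open sets and, through the radius [1 / (n + 1)], the depth of the
    erosion. *)
Lemma lebesgue_number_nat K (U : nat -> set X) : closed K ->
  (forall i, open (U i)) -> K `<=` \bigcup_i U i ->
  exists n e, 0 < e /\ K `<=` \big[setU/set0]_(i < n) inner (U i) e.
Proof.
move=> cK oU KU.
have cptK : compact K by exact: subclosed_compact cK cptX _.
have := (compact_near_coveringP K).1 cptK nat \oo
  (fun n x => (\big[setU/set0]_(i < n) inner (U i) n.+1%:R^-1) x).
move=> [] // => [x Kx|n _ /(_ n (leqnn n)) KP]; last first.
  by exists n, n.+1%:R^-1; split => //; rewrite invr_gt0.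
have [i _ Uix] := KU _ Kx.
have /nbhs_ballP[r /= r0 xr] := open_nbhs_nbhs (conj (oU i) Uix).
have r20 : 0 < r / 2 by rewrite divr_gt0.
near=> y n.
rewrite -(bigcup_mkord n (fun i => inner (U i) n.+1%:R^-1)).
exists i => /=; first by near: n; exists i.+1.
move=> z yz; apply: xr; rewrite (splitr r); apply: (@ball_triangle _ _ y).
  by near: y; exact: (nbhsx_ballx x _ r20).
apply: le_ball yz; apply/ltW.
by near: n; exact: (near_infty_natSinv_lt (PosNum r20)).
Unshelve. all: by end_near. Qed.

(** An erosion of the union is compact, hence covered by finitely many erosions
    of the given open sets, where the finite subadditivity of [L] applies. *)
Lemma inner_content_sigma_subadd (U : nat -> set X) : (forall i, open (U i)) ->
  ((inner_content (\bigcup_i U i))%:E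
   <= \sum_(i <oo) (inner_content (U i))%:E)%E.
Proof.
move=> oU; set S := (X in (_ <= X)%E).
have S0 : (0 <= S)%E.
  by apply: nneseries_ge0 => i _ _; rewrite lee_fin inner_content_ge0.
have [->|Soo] := eqVneq S +oo%E; first by rewrite leey.
have fS : S \is a fin_num by rewrite ge0_fin_numE// ltey.
rewrite -(fineK fS) lee_fin; apply: inner_content_le => e e0.
have [n [r [r0 Kr]]] := lebesgue_number_nat (@closed_inner _ e) oU
  (@inner_sub (\bigcup_i U i) e e0).
rewrite -lee_fin fineK//.
apply: (@le_trans _ _ (\sum_(i < n) (inner_content (U i))%:E)%E).
  rewrite sumEFin lee_fin; apply: le_trans (content_le Kr) _.
  apply: le_trans (content_bigsubadd (fun i => inner (U i) r) n) _.
  by apply: ler_sum => i _; exact: le_inner_content.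
rewrite -(big_mkord xpredT (fun i => (inner_content (U i))%:E)).
by apply: nneseries_lim_ge => i _ _; rewrite lee_fin inner_content_ge0.
Qed.

Lemma outer_content_sigma_subadd :
  sigma_subadditive (fun A => (outer_content A)%:E).
Proof.
move=> A; apply/lee_addgt0Pr => e e0.
rewrite (le_trans _ (epsilon_trick _ _ (ltW e0)))//; last first.
  by move=> n; rewrite lee_fin outer_content_ge0.
have /choice[U PU] n : exists U, [/\ open U, A n `<=` U &
    inner_content U <= outer_content (A n) + e / (2 ^ n.+1)%:R].
  have en : 0 < e / (2 ^ n.+1)%:R.
    by rewrite divr_gt0// ltr0n expn_gt0.
  have : has_inf [set inner_content U | U in [set U | open U /\ A n `<=` U]].
    split; last by exists 0 => _ [V _ <-]; exact: inner_content_ge0.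
    by exists (inner_content setT), setT => //; split => //; exact: openT.
  move/(inf_adherent en) => [_ [U [oU AU] <-] /ltW ?].
  by exists U.
apply: (@le_trans _ _ (inner_content (\bigcup_n U n))%:E).
  rewrite lee_fin; apply: outer_content_le.
    by apply: bigcup_open => i _; case: (PU i).
  by apply: subset_bigcup => i _; case: (PU i).
apply: le_trans (inner_content_sigma_subadd _) _; first
  by move=> i; case: (PU i).
apply: lee_nneseries => [i _ _|i _]; first by rewrite lee_fin inner_content_ge0.
by rewrite lee_fin; case: (PU i).
Qed.

(** Mass can only move from an open set to its boundary under regularisation,
    whence the inequality; the whole space has no boundary and keeps mass 1. *)
Theorem content_regularization :
  exists mu : probability (borel X) R, forall U, open U -> (mu U <= (L U)%:E)%E.
Proof.
pose mo := isOuterMeasure.Build R X (fun A => (outer_content A)%:E)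
  (congr1 EFin outer_content0)
  (fun A => outer_content_ge0 A)
  (fun A B AB => outer_contentS AB)
  outer_content_sigma_subadd.
pose om : {outer_measure set X -> \bar R} :=
  HB.pack (fun A : set X => (outer_content A)%:E) mo.
have omU U : open U -> om.-caratheodory U.
  move=> oU; apply: le_caratheodory_measurable => A /=.
  rewrite -EFinD lee_fin; apply: le_outer_content => V oV AV.
  apply: le_trans (outer_content_split oU oV).
  by rewrite lerD// outer_contentS//; exact: setSI.
have [mu muE] := @caratheodory_borel R X om omU (congr1 EFin outer_contentT).
exists mu => U oU; rewrite muE /= lee_fin.
exact: le_trans (outer_content_le oU _) (inner_content_le_content _).
Qed.

End regularization.

(** * Bowen metrics and maximal Birkhoff sums *)

Section uniform_continuity.
Context {R : realType} {X : metricType R}.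

Lemma compact_unif_continuous (phi : X -> R) (e : R) :
  compact [set: X] -> continuous phi -> 0 < e ->
  exists d, 0 < d /\ forall x y, mdist x y < d -> `|phi x - phi y| <= e.
Proof.
move=> cptX cphi e0.
have := (compact_near_coveringP _).1 cptX R 0^'+
  (fun d x => forall y, mdist x y < d -> `|phi x - phi y| <= e).
move=> [] => [x _|d /= d0 Pd]; last first.
  exists (d / 2); split; first by rewrite divr_gt0.
  move=> x y xy; apply: (Pd (d / 2)) => //=; rewrite ?divr_gt0//.
  by rewrite sub0r normrN gtr0_norm ?divr_gt0// ltr_pdivrMr// ltr_pMr// ltr1n.
have e20 : 0 < e / 2 by rewrite divr_gt0.
have /nbhs_ballP[r /= r0 xr] : \forall y \near x, `|phi x - phi y| < e / 2.
  by have /cvgrPdist_lt := cphi x; exact.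
have r20 : 0 < r / 2 by rewrite divr_gt0.
(* Two points at distance less than [r / 2], one of them [r / 2]-close to the
   centre [x], are compared through [x]. *)
near=> y d => /= z yz.
have xy : ball x (r / 2) y by near: y; exact: nbhsx_ballx.
have dr : d < r / 2 by near: d; exact: nbhs_right_lt.
have hy : `|phi x - phi y| < e / 2.
  by apply: xr; apply: le_ball xy; lra.
have hz : `|phi x - phi z| < e / 2.
  apply: xr; rewrite (splitr r); apply: ball_triangle xy _.
  by rewrite ballEmdist /=; apply: lt_trans dr.
have -> : phi y - phi z = (phi x - phi z) - (phi x - phi y) by ring.
by apply: le_trans (ler_normB _ _) _; lra.
Unshelve. all: by end_near. Qed.

End uniform_continuity.

Section bowen.
Context {R : realType} {X : metricType R}.
Variable f : naifs X.
Implicit Types (x y z : X) (n : nat) (r d : R).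

Lemma word_inh n : exists w : word f n, True.
Proof.
have a j : {a : alphabet f j | True}.
  by have /card_gt0P/sigW[a _] := alphabet_gt0 f j; exists a.
by exists [ffun j : 'I_n => sval (a j)].
Qed.

Lemma branch_continuous n (w : word f n) k : continuous (branch w k).
Proof.
elim: k => [|k ih] x /=; first exact: cvg_id.
case: insub => [j|]; last exact: ih.
by apply: continuous_comp; [exact: ih|exact: stage_map_continuous].
Qed.

Lemma bowen_dist_ge0 n x y : 0 <= bowen_dist f n x y.
Proof. by rewrite /bowen_dist; apply: bigmax_ge_id. Qed.

Lemma mdist_le_bowen n (w : word f n) t x y : (t <= n)%N ->
  mdist (branch w t x) (branch w t y) <= bowen_dist f n x y.
Proof.
move=> tn; have tn1 : (t < n.+1)%N by [].
rewrite /bowen_dist; apply: le_trans (le_bigmax _ _ w).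
exact: (le_bigmax _ (fun t : 'I_n.+1 => mdist (branch w t x) (branch w t y))
  (Ordinal tn1)).
Qed.

Lemma bowen_le n x y r : 0 <= r ->
  (forall (w : word f n) t, (t <= n)%N ->
    mdist (branch w t x) (branch w t y) <= r) -> bowen_dist f n x y <= r.
Proof.
move=> r0 h; apply: bigmax_le => // w _; apply: bigmax_le => // t _.
by apply: h; rewrite -ltnS.
Qed.

Lemma bowen_lt n x y r : 0 < r ->
  (forall (w : word f n) (t : 'I_n.+1),
    mdist (branch w t x) (branch w t y) < r) -> bowen_dist f n x y < r.
Proof. by move=> r0 h; apply: bigmax_lt => // w _; exact: bigmax_lt. Qed.

Lemma bowen_distxx n x : bowen_dist f n x x = 0.
Proof.
apply/eqP; rewrite eq_le bowen_dist_ge0 andbT.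
by apply: bowen_le => // w t _; rewrite mdistxx.
Qed.

Lemma bowen_sym n x y : bowen_dist f n x y = bowen_dist f n y x.
Proof.
wlog suff h : x y / bowen_dist f n x y <= bowen_dist f n y x.
  by apply/eqP; rewrite eq_le !h.
apply: bowen_le => [|w t tn]; first exact: bowen_dist_ge0.
by rewrite metric_sym; exact: mdist_le_bowen.
Qed.

Lemma bowen_triangle n y x z :
  bowen_dist f n x z <= bowen_dist f n x y + bowen_dist f n y z.
Proof.
apply: bowen_le => [|w t tn]; first by rewrite addr_ge0 ?bowen_dist_ge0.
rewrite (le_trans (metric_triangle _ (branch w t y) _))//.
by rewrite lerD// mdist_le_bowen.
Qed.

Lemma bowen_ball_nbhs n x r : 0 < r -> nbhs x (bowen_ball f n x r).
Proof.
move=> r0.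
have near_wt (w : word f n) (t : 'I_n.+1) :
    nbhs x [set y | mdist (branch w t x) (branch w t y) < r].
  have : nbhs x [set y | ball (branch w t x) r (branch w t y)].
    exact: (@branch_continuous n w t x _ (nbhsx_ballx _ _ r0)).
  by apply: filterS => y /=; rewrite ballEmdist.
have near_w (w : word f n) := filter_forall (nbhs_filter x) (near_wt w).
have := filter_forall (nbhs_filter x) near_w.
by apply: filterS => y h; exact: bowen_lt.
Qed.

Lemma open_bowen_ball n x r : open (bowen_ball f n x r).
Proof.
rewrite openE => y xy; rewrite /bowen_ball /= in xy.
have r0 : 0 < r - bowen_dist f n x y by rewrite subr_gt0.
apply: filterS (bowen_ball_nbhs n y r0) => z; rewrite /bowen_ball /= => yz.
by have := bowen_triangle n y x z; lra.
Qed.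

Lemma le_bowen_ball n x r r' : r <= r' ->
  bowen_ball f n x r `<=` bowen_ball f n x r'.
Proof. by move=> rr' y /lt_le_trans; exact. Qed.

Lemma bowen_ballD n x y r r' : bowen_ball f n x r y ->
  bowen_ball f n y r' `<=` bowen_ball f n x (r + r').
Proof.
rewrite /bowen_ball /= => xy z /= yz.
have := bowen_triangle n y x z; lra.
Qed.

Lemma bowen_ball_sym n x y r : bowen_ball f n x r y -> bowen_ball f n y r x.
Proof. by rewrite /bowen_ball /= bowen_sym. Qed.

Section max_sum.
Variable phi : X -> R.

Lemma word_sum_le_max n (w : word f n) x :
  word_sum phi w x <= max_sum f phi n x.
Proof.
apply: ub_le_sup; last by exists w.
exists (\big[Order.max/0]_(w : word f n) word_sum phi w x) => _ [v _ <-].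
exact: (le_bigmax _ (fun w : word f n => word_sum phi w x)).
Qed.

Lemma max_sum_le n x c : (forall w : word f n, word_sum phi w x <= c) ->
  max_sum f phi n x <= c.
Proof.
move=> h; apply: ge_sup; last by move=> _ [w _ <-].
by have [w _] := word_inh n; exists (word_sum phi w x), w.
Qed.

(** A word that is optimal for [x] can be used as a competitor for [y], since
    the Bowen metric controls the orbits along all the words simultaneously. *)
Lemma max_sum_close n e d x y :
  (forall x y, mdist x y < d -> `|phi x - phi y| <= e) ->
  bowen_dist f n x y < d -> max_sum f phi n x <= max_sum f phi n y + e * n%:R.
Proof.
move=> hphi xy; apply: max_sum_le => w.
apply: le_trans (_ : word_sum phi w y + e * n%:R <= _); last first.
  by rewrite lerD2r word_sum_le_max.
rewrite mulr_natr -[n in _ *+ n]card_ord -sumr_const -big_split /=.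
apply: ler_sum => i _; rewrite -lerBlDl.
apply: le_trans (ler_norm _) _; apply: hphi; apply: le_lt_trans xy.
by apply: mdist_le_bowen; exact/ltnW.
Qed.

Lemma max_sum_continuous n : compact [set: X] -> continuous phi ->
  continuous (max_sum f phi n).
Proof.
move=> cptX cphi x; apply/cvgrPdist_le => e e0.
have en0 : 0 < e / n.+1%:R by rewrite divr_gt0.
have [d [d0 hd]] := compact_unif_continuous cptX cphi en0.
have := bowen_ball_nbhs n x d0; apply: filterS => y xy.
have ne : e / n.+1%:R * n%:R <= e.
  by rewrite mulrAC ler_pdivrMr// ler_wpM2l// ?ltW// ltr_nat.
have h1 := max_sum_close hd xy.
have h2 := max_sum_close hd (bowen_ball_sym xy).
rewrite ler_distl lerBlDr; apply/andP; split.
  by rewrite (le_trans h2)// lerD2l.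
by rewrite (le_trans h1)// lerD2l.
Qed.

End max_sum.
End bowen.

(** * Weighted covers by Bowen balls *)

(** Pick any [z] in [A] and discard the weighted points within [d] of [z] as
    well as the part of [A] within [2 d] of [z]. The discarded weights total at
    least [t], which pays for [z]; the remaining part of [A] is out of their
    reach, so it still receives mass [t] from the weights that are kept. *)
Lemma greedy_cover {R : realType} {T : eqType} (rho : T -> T -> R) (u : T -> R)
    (K t d : R) (F : seq (R * T)) (A : set T) :
  (forall x y, rho x y = rho y x) ->
  (forall y x z, rho x z <= rho x y + rho y z) ->
  (forall x, 0 <= u x) -> (forall x z, rho x z < d -> u z <= K * u x) ->
  0 <= K -> 0 < t -> all (fun c => 0 <= c.1) F ->
  (forall z, A z -> t <= \sum_(c <- F | rho c.2 z < d) c.1) ->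
  exists G : seq T,
    (forall z, A z -> exists2 g, g \in G & rho g z < d + d) /\
    t * \sum_(g <- G) u g <= K * \sum_(c <- F) c.1 * u c.2.
Proof.
move=> rhoC rhoD u0 uK K0 t0; move: {2}(size F).+1 (ltnSn (size F)) => m.
elim: m F A => [//|m ih] F A Fm F0 FA.
have [[z Az]|A0] := pselect (A !=set0); last first.
  exists [::]; split=> [z Az|]; first by case: A0; exists z.
  rewrite big_nil mulr0 mulr_ge0// big_seq sumr_ge0// => c cF.
  by rewrite mulr_ge0// (allP F0).
pose far := [pred c : R * T | ~~ (rho c.2 z < d)].
have [|||G [GA Gt]] := ih [seq c <- F | far c]
  (A `&` [set y | ~ rho z y < d + d]).
- rewrite -ltnS (leq_trans _ Fm)// ltnS ltn_neqAle size_filter count_size andbT.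
  rewrite -all_count; apply: contraTN (FA _ Az) => /allP Ffar.
  rewrite -ltNge big_seq_cond big1 // => c /andP[/Ffar/=].
  by move=> /negP.
- by apply/allP => c; rewrite mem_filter => /andP[_ /(allP F0)].
- move=> y [Ay /= zy]; rewrite big_filter_cond (le_trans (FA _ Ay))//.
  rewrite le_eqVlt; apply/orP; left; apply/eqP; apply: eq_bigl => c.
  case: (ltP (rho c.2 y) d) => cy; rewrite ?andbF ?andbT//.
  apply/esym/negP => cz.
  by apply: zy; have := rhoD c.2 z y; rewrite (rhoC z c.2); lra.
exists (z :: G); split=> [y Ay|].
  have [zy|zy] := pselect (rho z y < d + d); first by exists z;
    rewrite ?mem_head.
  have [|g gG gy] := GA y; first by [].
  by exists g => //; rewrite in_cons gG orbT.
rewrite big_cons mulrDr (bigID far)/= mulrDr addrC lerD//.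
  by rewrite big_filter in Gt.
apply: le_trans (_ : (\sum_(c <- F | rho c.2 z < d) c.1) * u z <= _).
  by rewrite ler_wpM2r// FA.
rewrite mulr_suml mulr_sumr big_seq_cond [leRHS]big_seq_cond.
under [leRHS]eq_bigl do rewrite negbK.
apply: ler_sum => c /andP[cF cz]; rewrite mulrCA ler_wpM2l ?uK//.
exact: (allP F0).
Qed.

Section geometric.
Context {R : realType}.

(** The thresholds [exp(- e n)] are affordable on the exponential scale, and
    yet those of all high levels together stay below the mass 1 of a point. *)
Lemma geometric_tail (e : R) : 0 < e -> exists N0, forall N M, (N0 <= N)%N ->
  \sum_(N <= n < M) expR (- (e * n%:R)) < 1.
Proof.
move=> e0; pose q := expR (- e).
have q0 : 0 < q by exact: expR_gt0.
have q1 : q < 1 by rewrite /q expR_lt1 oppr_lt0.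
have qn n : expR (- (e * n%:R)) = q ^+ n.
  by rewrite -mulNr mulrC expRM_natl.
have : \forall n \near \oo, q ^+ n < 1 - q.
  have : (fun n => q ^+ n) @ \oo --> 0.
    by apply: cvg_expr; rewrite gtr0_norm.
  by move/cvgr_lt; apply; rewrite subr_gt0.
move=> [N0 _ hN0]; exists N0 => N M N0N.
under eq_bigr do rewrite qn.
have [MN|/ltnW NM] := leqP M N; first by rewrite big_geq.
have tele : (1 - q) * \sum_(N <= n < M) q ^+ n = q ^+ N - q ^+ M.
  rewrite mulr_sumr -[RHS]opprB -telescope_sumr// -sumrN.
  by apply: eq_bigr => n _; rewrite exprS; ring.
have := hN0 N N0N; have : 0 < q ^+ M by rewrite exprn_gt0.
move: tele; set S := \sum_(_ <= _ < _) _ => tele qM qN.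
have q10 : 0 < 1 - q by rewrite subr_gt0.
rewrite -(ltr_pM2l q10) tele mulr1; lra.
Qed.

End geometric.

Lemma big_by_level {R : realType} {T : Type} (lev : T -> nat) (F : seq T)
    (P : pred T) (g : T -> R) (N M : nat) :
  all (fun c => N <= lev c < M)%N F ->
  \sum_(c <- F | P c) g c =
  \sum_(N <= n < M) \sum_(c <- F | (lev c == n) && P c) g c.
Proof.
elim: F => [|c F ih] /=.
  by move=> _; rewrite big_nil big1// => n _; rewrite big_nil.
move=> /andP[cNM /ih{}ih]; rewrite big_cons.
under [RHS]eq_bigr do rewrite big_cons.
transitivity (\sum_(N <= n < M) ((if (lev c == n) && P c then g c else 0) +
    \sum_(c <- F | (lev c == n) && P c) g c)); last first.
  by apply: eq_bigr => n _; case: ifP => //; rewrite add0r.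
rewrite big_split /= -ih -big_mkcond /=.
case: (P c) => /=; last first.
  by rewrite [X in _ = X + _]big1 ?add0r// => n; rewrite andbF.
congr (_ + _).
rewrite big_mkcond (bigD1_seq (lev c)) ?mem_index_iota ?iota_uniq//=.
rewrite eqxx big1 ?addr0// => n.
by rewrite eq_sym andbT => /negbTE ->.
Qed.

Section weighted_covers.
Context {R : realType} {X : pointedMetricType R}.
Variables (f : naifs X) (phi : X -> R).
Implicit Types (Z : set X) (a d e : R) (N : nat).

Definition bowen_weight a (b : nat * X) : R :=
  expR (- a * b.1%:R + max_sum f phi b.1 b.2).

Lemma bowen_weight_gt0 a b : 0 < bowen_weight a b.
Proof. exact: expR_gt0. Qed.

Lemma cover_sum_le Z a d N (G : seq (nat * X)) :
  all (fun b => N <= b.1)%N G ->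
  (forall z, Z z -> exists2 b, b \in G & bowen_ball f b.1 b.2 d z) ->
  (cover_sum Z f phi a d N <= (\sum_(b <- G) bowen_weight a b)%:E)%E.
Proof.
move=> GN GZ; apply: ereal_inf_lbound.
pose g i := nth (0%N, point : X) G i.
exists `I_(size G), (fst \o g), (snd \o g); split.
- by move=> i /= iG; apply: (allP GN); exact: mem_nth.
- move=> z /GZ[b bG bz]; exists (index b G); first by rewrite /= index_mem.
  by rewrite /= /g nth_index.
have w0 i : i \in `I_(size G) -> (0 <= (bowen_weight a (g i))%:E)%E.
  by rewrite lee_fin expR_ge0.
transitivity (\sum_(i \in `I_(size G)) (bowen_weight a (g i))%:E)%E; last first.
  by apply/esym/esum_fset => //; exact: finite_II.
transitivity (\sum_(i < size G) (bowen_weight a (g i))%:E)%E; last first.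
  exact: fsbig_ord.
by rewrite (big_nth (0%N, point : X)) big_mkord sumEFin.
Qed.

Lemma cover_sum_ge0 Z a d N : (0 <= cover_sum Z f phi a d N)%E.
Proof.
apply: le_ereal_inf_tmp => _ [D [n [x [_ _ ->]]]].
by apply: esum_ge0 => i _; rewrite lee_fin expR_ge0.
Qed.

Definition weighted_family N (F : seq (R * (nat * X))) :=
  all (fun c => (0 <= c.1) && (N <= c.2.1)%N) F.

Definition cost a (F : seq (R * (nat * X))) : R :=
  \sum_(c <- F) c.1 * bowen_weight a c.2.

Definition mass d (F : seq (R * (nat * X))) (z : X) : R :=
  \sum_(c <- F | bowen_dist f c.2.1 c.2.2 z < d) c.1.

Lemma weighted_familyP N F : weighted_family N F ->
  forall c, c \in F -> 0 <= c.1 /\ (N <= c.2.1)%N.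
Proof. by move=> /allP FN c /FN/andP. Qed.

Lemma cost_ge0 a N F : weighted_family N F -> 0 <= cost a F.
Proof.
move=> FN; rewrite /cost big_seq sumr_ge0// => c /(weighted_familyP FN)[c0 _].
by rewrite mulr_ge0// ltW// bowen_weight_gt0.
Qed.

(** Weighted covers are not cheaper than covers on the exponential scale. One
    [e] is lost to the threshold [exp(- e n)] selecting the level [n] at which
    a point is covered substantially, the other to the variation of Birkhoff
    sums on a Bowen ball of radius [d]. *)
Lemma cover_sum_le_cost Z a d e N F :
  (forall x y, mdist x y < d -> `|phi x - phi y| <= e) ->
  (forall M, \sum_(N <= n < M) expR (- (e * n%:R)) < 1) ->
  weighted_family N F -> (forall z, Z z -> 1 <= mass d F z) ->
  (cover_sum Z f phi (a + e + e) (d + d) N <= (cost a F)%:E)%E.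
Proof.
move=> hphi tail FN FZ.
pose M := (\max_(c <- F) c.2.1).+1.
have FNM : all (fun c => N <= c.2.1 < M)%N F.
  apply/allP => c cF; have [_ ->/=] := weighted_familyP FN cF.
  by rewrite ltnS; apply: leq_bigmax_seq.
pose t n := expR (- (e * n%:R)).
pose Fn n := [seq (c.1, c.2.2) | c <- F & c.2.1 == n].
pose A n := Z `&` [set z |
  t n <= \sum_(c <- F | (c.2.1 == n) && (bowen_dist f c.2.1 c.2.2 z < d)) c.1].
have /choice[G GP] n : exists G : seq X,
    (forall z, A n z -> exists2 g, g \in G & bowen_dist f n g z < d + d) /\
    t n * \sum_(g <- G) expR (max_sum f phi n g) <=
    expR (e * n%:R) * \sum_(c <- Fn n) c.1 * expR (max_sum f phi n c.2).
  apply: (@greedy_cover _ _ (bowen_dist f n)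
    (fun x => expR (max_sum f phi n x)) _ _ d _ (A n)).
  - exact: bowen_sym.
  - exact: bowen_triangle.
  - by move=> x; exact: expR_ge0.
  - move=> x z xz; rewrite -expRD ler_expR addrC; apply: max_sum_close hphi _.
    by rewrite bowen_sym.
  - exact: expR_ge0.
  - exact: expR_gt0.
  - rewrite all_map; apply/allP => c; rewrite mem_filter => /andP[_ cF] /=.
    by have [] := weighted_familyP FN cF.
  - move=> z [_ /le_trans]; apply; rewrite big_map big_filter_cond /=.
    rewrite le_eqVlt; apply/orP; left; apply/eqP/eq_bigl => c.
    by case: eqP => [->|].
pose H := [seq (n, g) | n <- index_iota N M, g <- G n].
apply: le_trans (@cover_sum_le _ _ _ _ H _ _) _.
- apply/allP => _ /allpairsPdep[n [g [+ _ ->]]].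
  by rewrite mem_index_iota => /andP[].
(* A point below the threshold at every level would have mass less than 1. *)
- move=> z Zz; have [n nNM Anz] : exists2 n, n \in index_iota N M & A n z.
    apply: contrapT => /forall2NP noA; have := FZ _ Zz; apply/negP.
    rewrite -ltNge /mass (big_by_level _ _ FNM); apply: le_lt_trans (tail M).
    rewrite big_seq [leRHS]big_seq; apply: ler_sum => n nNM.
    by have [//|/not_andP[//|/negP]] := noA n; rewrite -ltNge => /ltW.
  have [g gG gz] := (GP n).1 z Anz.
  by exists (n, g) => //; apply: allpairs_f_dep.
rewrite lee_fin big_allpairs_dep /= /cost (big_by_level _ _ FNM).
apply: ler_sum => n _.
have := (GP n).2; rewrite /t /Fn big_map big_filter => Gn.
rewrite [leRHS](_ : _ = expR (- (a * n%:R)) *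
    \sum_(c <- F | c.2.1 == n) c.1 * expR (max_sum f phi n c.2.2)); last first.
  rewrite mulr_sumr; under eq_bigl do rewrite andbT.
  by apply: eq_bigr => c /eqP <-; rewrite mulrCA -expRD /bowen_weight mulNr.
rewrite [leLHS](_ : _ = expR (- ((a + e) * n%:R)) *
    (expR (- (e * n%:R)) * \sum_(g <- G n) expR (max_sum f phi n g))).
  apply: le_trans (ler_wpM2l (expR_ge0 _) Gn) _.
  by rewrite mulrA -expRD [X in expR X](_ : _ = - (a * n%:R)) //; ring.
rewrite mulrA -expRD mulr_sumr; apply: eq_bigr => g _.
by rewrite /bowen_weight /= -expRD; congr expR; ring.
Qed.

End weighted_covers.

(** * A Frostman lemma *)

Lemma fimfun_ubound {R : realType} {T : Type} (g : {fimfun T >-> R}) :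
  exists b, 0 <= b /\ forall x, g x <= b.
Proof.
have /finite_seqP[s gs] := fimfunP g.
exists (\big[Order.max/0]_(y <- s) y); split; first exact: bigmax_ge_id.
move=> x; apply: (@le_bigmax_seq _ _ _ s 0 (g x) xpredT id) => //.
by have : range g (g x) by []; rewrite gs.
Qed.

Lemma fimfunMn {R : realType} {T : Type} (g : {fimfun T >-> R}) n x :
  (g *+ n) x = g x *+ n.
Proof. by elim: n => // n ih; rewrite !mulrSr fimfunD /= ih. Qed.

Section frostman.
Context {R : realType} {X : pointedMetricType R}.
Variables (f : naifs X) (phi : X -> R) (Z : set X) (a d : R) (N : nat).
Implicit Types (F : seq (R * (nat * X))) (g : {fimfun X >-> R}).

Definition dominates g F :=
  weighted_family N F /\ forall z, Z z -> g z <= mass f d F z.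

(** On the indicator of [Z] this is the weighted analogue of [cover_sum]; as a
    functional of [g] it is the gauge to which Hahn-Banach duality applies. *)
Definition covering_cost g : R := inf [set cost f phi a F | F in dominates g].

Lemma covering_cost_le g F : dominates g F -> covering_cost g <= cost f phi a F.
Proof.
by apply: (inf_image_le (c := 0)) => H [HN _]; exact: cost_ge0 HN.
Qed.

Lemma mass_cat F H z : mass f d (F ++ H) z = mass f d F z + mass f d H z.
Proof. by rewrite /mass big_cat. Qed.

Lemma cost_cat F H : cost f phi a (F ++ H) = cost f phi a F + cost f phi a H.
Proof. by rewrite /cost big_cat. Qed.

Definition scale_family (k : R) F := [seq (k * c.1, c.2) | c <- F].

Lemma mass_scale k F z : mass f d (scale_family k F) z = k * mass f d F z.
Proof. by rewrite /mass big_map mulr_sumr. Qed.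

Lemma cost_scale k F : cost f phi a (scale_family k F) = k * cost f phi a F.
Proof.
by rewrite /cost big_map mulr_sumr; apply: eq_bigr => c _; rewrite mulrA.
Qed.

Lemma weighted_family_scale k F : 0 <= k -> weighted_family N F ->
  weighted_family N (scale_family k F).
Proof.
move=> k0 FN; rewrite /weighted_family all_map; apply/allP => c cF /=.
by have [c0 ->] := weighted_familyP FN cF; rewrite mulr_ge0.
Qed.

(** The empty family dominates [g]: this makes functionals below the cost
    positive and concentrated on [Z]. *)
Lemma covering_cost_npos g : (forall z, Z z -> g z <= 0) ->
  covering_cost g <= 0.
Proof.
move=> g0; rewrite -[leRHS](_ : cost f phi a [::] = 0); last exact: big_nil.
apply: covering_cost_le; split => // z Zz.
by rewrite /mass big_nil g0.
Qed.

Hypothesis d0 : 0 < d.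
Hypothesis cptZ : compact Z.

(** Finitely many balls cover the compact set [Z]; a large common weight on
    them dominates [g], which takes finitely many values. *)
Lemma exists_dominating g : dominates g !=set0.
Proof.
have [b [b0 gb]] := fimfun_ubound g.
have oB (x : X) : Z x -> open (bowen_ball f N x d).
  by move=> _; exact: open_bowen_ball.
have ZB : Z `<=` cover Z (fun x => bowen_ball f N x d).
  by move=> z Zz; exists z => //; rewrite /bowen_ball /= bowen_distxx.
have [D _ ZD] : finite_subset_cover Z (fun x => bowen_ball f N x d) Z.
  by move: cptZ; rewrite compact_cover; apply.
exists [seq (b, (N, x)) | x <- finmap.enum_fset D]; split.
  by rewrite /weighted_family all_map; apply/allP => x _ /=; rewrite b0 leqnn.
move=> z /ZD[x /= xD xz]; apply: le_trans (gb z) _.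
rewrite /mass big_map /= (big_rem x)//=.
move: xz; rewrite /bowen_ball /= => ->.
by rewrite lerDl sumr_ge0.
Qed.

Lemma sublinear_covering_cost : sublinear covering_cost.
Proof.
split=> [g h|g n].
  apply: le_add_inf_image; [exact: exists_dominating|exact: exists_dominating|].
  move=> F H [FN gF] [HN hH]; rewrite -cost_cat; apply: covering_cost_le; split.
    by rewrite /weighted_family all_cat; apply/andP; split.
  by move=> z Zz; rewrite mass_cat lerD ?gF ?hH.
apply: le_inf_image => [|F [FN gF]]; first exact: exists_dominating.
case: n gF => [|n] gF; first by rewrite mulr0n; exact: cost_ge0 FN.
have n0 : 0 <= n.+1%:R^-1 :> R by rewrite invr_ge0.
rewrite -mulr_natr -ler_pdivlMr// mulrC -cost_scale; apply: covering_cost_le.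
split; first exact: weighted_family_scale.
move=> z Zz; rewrite mass_scale mulrC ler_pdivlMr// mulr_natr.
by apply: le_trans (gF z Zz); rewrite fimfunMn.
Qed.

(** Below [covering_cost], an additive functional cannot give a ball more than
    its weight, since the ball alone, with coefficient 1, dominates its own
    indicator. The lower bound [c] is what allows the normalisation by the
    value at 1, and regularisation keeps the bound because Bowen balls and the
    complement of [Z] are open. *)
Theorem frostman (c : R) : compact [set: X] -> 0 < c ->
  (forall F, weighted_family N F -> (forall z, Z z -> 1 <= mass f d F z) ->
    c <= cost f phi a F) ->
  exists mu : probability (borel X) R, mu Z = 1%E /\
    forall n x, (N <= n)%N ->
      (mu (bowen_ball f n x d) <= (bowen_weight f phi a (n, x) / c)%:E)%E.
Proof.
move=> cptX c0 cF; pose one : {fimfun X >-> R} := indic_fimfun setT.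
have [L [LD Lp L1]] := hahn_banach one sublinear_covering_cost.
have p1 : c <= covering_cost one.
  apply: le_inf_image => [|F [FN oneF]]; first exact: exists_dominating.
  by apply: cF => // z /oneF; rewrite /one /= indicT.
have p0 : 0 < covering_cost one by exact: lt_le_trans p1.
have L0 : L 0 = 0 by have := LD 0 0; rewrite addr0; lra.
have LN g : L (- g) = - L g by have := LD g (- g); rewrite subrr L0; lra.
pose I (A : set X) := L (indic_fimfun A) / L one.
have I_ge0 A : 0 <= I A.
  rewrite /I L1 divr_ge0 ?(ltW p0)// -[leRHS]opprK -LN oppr_ge0.
  apply: le_trans (Lp _) _; apply: covering_cost_npos => z _.
  by rewrite fimfunN /= oppr_le0 indicE.
have IT : I setT = 1 by rewrite /I divff// L1 gt_eqF.
have IU A B : A `&` B = set0 -> I (A `|` B) = I A + I B.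
  move=> AB; rewrite /I -mulrDl -LD; congr (L _ / _).
  apply/fimfuneqP => z; rewrite fimfunD /= !indicE in_setU.
  have : z \notin A `&` B by rewrite AB in_set0.
  by rewrite in_setI; do 2 case: (z \in _) => //; rewrite ?addr0 ?add0r.
have [mu muI] := content_regularization I_ge0 IT IU cptX.
have clZ : closed Z by apply: compact_closed => //; exact: metric_hausdorff.
have muZC : mu (~` Z) = 0%E.
  apply/eqP; rewrite eq_le measure_ge0 andbT.
  apply: le_trans (muI _ (closed_openC clZ)) _; rewrite lee_fin /I.
  rewrite pmulr_lle0 ?invr_gt0 ?L1//; apply: le_trans (Lp _) _.
  by apply: covering_cost_npos => z Zz /=; rewrite indicE memNset.
exists mu; split.
  have mZ : measurable (~` Z : set (borel X)).
    by apply: sub_sigma_algebra; exact: closed_openC.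
  by have := probability_setC mu mZ; rewrite muZC setCK sube0.
move=> n x Nn; apply: le_trans (muI _ (@open_bowen_ball _ _ f n x d)) _.
rewrite lee_fin /I L1.
apply: le_trans (_ : bowen_weight f phi a (n, x) / covering_cost one <= _).
  rewrite ler_pM2r ?invr_gt0//; apply: le_trans (Lp _) _.
  rewrite -[leRHS](_ : cost f phi a [:: (1, (n, x))] = _); last first.
    by rewrite /cost big_seq1 mul1r.
  apply: covering_cost_le; split; first by rewrite /weighted_family /= Nn ler01.
  move=> z _; rewrite /= indicE /mass big_cons big_nil /= addr0.
  by case: ifP => xz; [case: (_ \in _)|rewrite memNset// /bowen_ball /= xz].
by rewrite ler_pM2l ?expR_gt0// lef_pV2// posrE.
Qed.

End frostman.

(** * Limits of monotone scales and measurability of the local pressure *)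

Section ereal_limits.
Context {R : realType}.
Implicit Types (u v : nat -> \bar R) (F : R -> \bar R).
Local Open Scope ereal_scope.

Lemma limn_einfE u : limn_einf u = ereal_sup (range (einfs u)).
Proof. by rewrite limn_einf_lim; apply/cvg_lim => //; exact: cvg_einfs_sup. Qed.

Lemma le_limn_einf u v : (forall n, u n <= v n) -> limn_einf u <= limn_einf v.
Proof.
move=> uv; rewrite !limn_einfE; apply: ge_ereal_sup => _ [n _ <-].
apply: le_trans (ereal_sup_ubound (_ : range (einfs v) (einfs v n)));
  last by exists n.
apply: le_ereal_inf_tmp => _ [k /= nk <-]; apply: le_trans (uv k).
by apply: ereal_inf_lbound; exists k.
Qed.

Lemma limn_einf_ge u c N : (forall n, (N <= n)%N -> c <= u n) ->
  c <= limn_einf u.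
Proof.
move=> uc; rewrite limn_einfE.
apply: le_trans (ereal_sup_ubound (_ : range (einfs u) (einfs u N)));
  last by exists N.
by apply: le_ereal_inf_tmp => _ [k /= Nk <-]; exact: uc.
Qed.

Lemma limn_einf_gt u c : c < limn_einf u ->
  exists N, forall n, (N <= n)%N -> c <= u n.
Proof.
rewrite limn_einfE => /ereal_sup_gt[_ [N _ <-] cN]; exists N => n Nn.
by apply: le_trans (ltW cN) _; apply: ereal_inf_lbound; exists n.
Qed.

Lemma lim_at_right0 F :
    (forall r r', (0 < r)%R -> (r <= r')%R -> F r' <= F r) ->
  lim (F r @[r --> 0^'+]) = ereal_sup [set F r | r in [set r | (0 < r)%R]].
Proof.
move=> Fni; apply/cvg_lim => //.
rewrite (_ : [set r | (0 < r)%R] = [set` `]0%R, +oo[ ]); last first.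
  by apply/seteqP; split=> r /=; rewrite in_itv /= andbT.
apply: nonincreasing_at_right_cvge => // r r'.
by rewrite !in_itv /= !andbT => r0 _; exact: Fni.
Qed.

Lemma limn_nondecreasing u : {homo u : n m / (n <= m)%N >-> n <= m} ->
  limn u = ereal_sup (range u).
Proof. by move=> und; apply/cvg_lim => //; exact: ereal_nondecreasing_cvgn. Qed.

Lemma expR_lt_lne (b : R) (m : \bar R) : 0 <= m ->
  (b%:E < lne m) = ((expR b)%:E < m).
Proof. by move=> m0; rewrite -lte_expeR lneK// in_itv /= m0 leey. Qed.

Lemma lte_real_between (x y : \bar R) : x < y ->
  exists s : R, x < s%:E /\ s%:E < y.
Proof.
case: x y => [x||] [y||]// xy.
- move: xy; rewrite lte_fin => xy.
  by exists ((x + y) / 2)%R; rewrite !lte_fin; split; lra.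
- by exists (x + 1)%R; rewrite lte_fin ltry; split => //; lra.
- by exists (y - 1)%R; rewrite lte_fin ltNyr; split => //; lra.
- by exists 0%R; rewrite ltry ltNyr.
Qed.

End ereal_limits.

Lemma nbhs_open {T : topologicalType} (A : set T) : A `<=` interior A -> open A.
Proof. by rewrite openE. Qed.

Section local_pressure.
Context {R : realType} {X : pointedMetricType R}.
Variables (f : naifs X) (phi : X -> R) (mu : probability (borel X) R).
Hypotheses (cptX : compact [set: X]) (cphi : continuous phi).
Local Open Scope ereal_scope.

Lemma open_measurable_borel (U : set X) :
  open U -> measurable (U : set (borel X)).
Proof. exact: sub_sigma_algebra. Qed.

Lemma measurable_lsc (g : X -> \bar R) :
  (forall b : R, open [set x | b%:E < g x]) ->
  measurable_fun [set: borel X] (g : borel X -> \bar R).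
Proof.
move=> og _; apply: (measurability _ (ErealGenOInfty.measurableE R)) => //.
move=> _ [_ [b ->] <-]; rewrite setTI; apply: open_measurable_borel.
rewrite (_ : _ @^-1` _ = [set x | b%:E < g x])//.
by apply/seteqP; split=> x /=; rewrite in_itv /= andbT.
Qed.

Lemma measurable_max_sum n :
  measurable_fun [set: borel X] (fun x : borel X => (max_sum f phi n x)%:E).
Proof.
apply: measurable_lsc => b; rewrite openE => x /= bx.
have /cvgr_gt/(_ b) := @max_sum_continuous _ _ f phi n cptX cphi x.
by rewrite -lte_fin => /(_ bx); apply: filterS => y /=; rewrite lte_fin.
Qed.

(** By continuity from below the measure of a slightly smaller ball around [x]
    already exceeds [b], and that ball is contained in the balls of radius [r]
    around the points near [x]. *)
Lemma open_measure_bowen_gt n r (b : R) :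
  open [set x | b%:E < mu (bowen_ball f n x r)].
Proof.
suff : [set x | b%:E < mu (bowen_ball f n x r)] `<=`
    interior [set x | b%:E < mu (bowen_ball f n x r)] by exact: nbhs_open.
move=> x /= bx; pose rk k : R := (r - k.+1%:R^-1)%R.
have rkr k : (rk k <= r)%R by rewrite gerBl invr_ge0.
have mB m y q : measurable (bowen_ball f m y q : set (borel X)).
  by apply: open_measurable_borel; exact: open_bowen_ball.
have BE : bowen_ball f n x r = \bigcup_k bowen_ball f n x (rk k).
  apply/seteqP; split=> [y|y [k _]]; last exact: le_bowen_ball.
  rewrite /bowen_ball /= -subr_gt0 => xy.
  have [k _ hk] := near_infty_natSinv_lt (PosNum xy).
  exists k => //=; rewrite /rk ltrBrDr -ltrBrDl; exact: (hk k (leqnn k)).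
have cvgB : (mu \o (fun k => bowen_ball f n x (rk k))) k @[k --> \oo] -->
    mu (bowen_ball f n x r).
  rewrite BE; apply: nondecreasing_cvg_mu => //.
    by apply: bigcup_measurable.
  move=> k m km; apply/subsetPset; apply: le_bowen_ball.
  by rewrite lerD2l lerN2 lef_pV2 ?posrE// ler_nat.
have [k bk] : exists k, b%:E < mu (bowen_ball f n x (rk k)).
  apply: contrapT => /forallNP nb; move: bx; apply/negP; rewrite -leNgt.
  have /cvg_lim <- // := cvgB; apply: lime_le; first exact: cvgP cvgB.
  by apply: nearW => k /=; rewrite leNgt; apply/negP/nb.
have k0 : (0 < k.+1%:R^-1 :> R)%R by rewrite invr_gt0.
apply: filterS (bowen_ball_nbhs f n x k0) => y xy.
apply: lt_le_trans bk _; apply: le_measure; rewrite ?inE//.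
have -> : r = (k.+1%:R^-1 + rk k)%R by rewrite /rk addrC subrK.
exact/bowen_ballD/bowen_ball_sym.
Qed.

Definition rate n r (x : X) : \bar R :=
  (- lne (mu (bowen_ball f n x r)) + (max_sum f phi n x)%:E) * (n%:R^-1)%:E.

Lemma measurable_rate n r :
  measurable_fun [set: borel X] (rate n r : borel X -> _).
Proof.
apply: emeasurable_funM; last exact: measurable_cst.
apply: emeasurable_funD; last exact: measurable_max_sum.
apply: measurableT_comp => //; apply: measurable_lsc => b.
rewrite (_ : [set x | _] = [set x | (expR b)%:E < mu (bowen_ball f n x r)]).
  exact: open_measure_bowen_gt.
by apply/funext => x /=; rewrite expR_lt_lne.
Qed.

Lemma le_rate n r r' x : (r <= r')%R -> rate n r' x <= rate n r x.
Proof.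
move=> rr'; apply: lee_wpmul2r; first by rewrite lee_fin invr_ge0.
rewrite leeD2r// leeN2 lee_lne ?in_itv/= ?measure_ge0 ?leey//.
apply: le_measure; rewrite ?inE; last exact: le_bowen_ball.
  by apply: open_measurable_borel; exact: open_bowen_ball.
by apply: open_measurable_borel; exact: open_bowen_ball.
Qed.

Lemma lower_local_pressureE x : lower_local_pressure mu f phi x =
  ereal_sup [set limn_einf (fun n => rate n r x) | r in [set r | (0 < r)%R]].
Proof.
by apply: lim_at_right0 => r r' _ rr'; apply: le_limn_einf => n; exact: le_rate.
Qed.

(** By monotonicity in the radius, the countably many radii [1 / (k + 1)]
    suffice. *)
Lemma measurable_lower_local_pressure :
  measurable_fun [set: borel X]
    (lower_local_pressure mu f phi : borel X -> \bar R).
Proof.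
pose G k (x : borel X) := limn_einf (fun n => rate n k.+1%:R^-1 x).
rewrite (_ : lower_local_pressure mu f phi = fun x => esups (G ^~ x) 0%N).
  apply: measurable_fun_esups => k; rewrite /G /limn_einf.
  apply: measurableT_comp => //; apply: measurable_fun_limn_esup => n.
  by apply: measurableT_comp => //; exact: measurable_rate.
apply/funext => x; rewrite lower_local_pressureE; apply/eqP.
rewrite eq_le; apply/andP; split.
  apply: ge_ereal_sup => _ [r /= r0 <-].
  have [k _ hk] := near_infty_natSinv_lt (PosNum r0).
  apply: le_trans (_ : G k x <= _).
    by apply: le_limn_einf => n; apply: le_rate; exact/ltW/(hk k)/leqnn.
  by apply: ereal_sup_ubound; exists k.
apply: ge_ereal_sup => _ [k _ <-]; apply: ereal_sup_ubound.
by exists (k.+1%:R^-1)%R => //=.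
Qed.

End local_pressure.

(** * The variational principle *)

Section pressure_scales.
Context {R : realType} {X : pointedMetricType R}.
Variables (f : naifs X) (phi : X -> R) (Z : set X).
Implicit Types (a d : R) (N : nat).
Local Open Scope ereal_scope.

Lemma le_cover_sum_level a d N M : (N <= M)%N ->
  cover_sum Z f phi a d N <= cover_sum Z f phi a d M.
Proof.
move=> NM; apply: le_ereal_inf => _ [D [n [x [Dn ZD ->]]]].
by exists D, n, x; split => // i Di; exact: leq_trans NM (Dn i Di).
Qed.

Lemma le_cover_sum_scale a d d' N : (d <= d')%R ->
  cover_sum Z f phi a d' N <= cover_sum Z f phi a d N.
Proof.
move=> dd'; apply: le_ereal_inf => _ [D [n [x [Dn ZD ->]]]].
exists D, n, x; split => // z /ZD[i Di zi]; exists i => //.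
exact: le_bowen_ball zi.
Qed.

Lemma cover_outerE a d :
  cover_outer Z f phi a d = ereal_sup (range (cover_sum Z f phi a d)).
Proof. by apply: limn_nondecreasing => N M; exact: le_cover_sum_level. Qed.

Lemma cover_outer_eq0P a d :
  cover_outer Z f phi a d = 0 <-> forall N, cover_sum Z f phi a d N = 0.
Proof.
rewrite cover_outerE; split=> [h N|h].
  apply/eqP; rewrite eq_le cover_sum_ge0 andbT -h.
  by apply: ereal_sup_ubound; exists N.
rewrite (_ : range _ = [set 0]) ?ereal_sup1//; apply/seteqP; split.
  by move=> _ [N _ <-]; rewrite h.
by move=> _ ->; exists 0%N.
Qed.

Lemma le_pressure_at_scale d d' : (d <= d')%R ->
  pressure_at_scale Z f phi d' <= pressure_at_scale Z f phi d.
Proof.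
move=> dd'; apply: le_ereal_inf => _ [a /= /cover_outer_eq0P h <-].
exists a => //=; apply/cover_outer_eq0P => N; apply/eqP.
by rewrite eq_le cover_sum_ge0 andbT -(h N) le_cover_sum_scale.
Qed.

Lemma pressureE : pressure Z f phi =
  ereal_sup [set pressure_at_scale Z f phi d | d in [set d | (0 < d)%R]].
Proof. by apply: lim_at_right0 => d d' _; exact: le_pressure_at_scale. Qed.

Lemma pressure_at_scale_le d : (0 < d)%R ->
  pressure_at_scale Z f phi d <= pressure Z f phi.
Proof. by move=> d0; rewrite pressureE; apply: ereal_sup_ubound; exists d. Qed.

Lemma pressure_at_scale_lt d (s : \bar R) : pressure_at_scale Z f phi d < s ->
  exists a, a%:E < s /\ forall N, cover_sum Z f phi a d N = 0.
Proof.
by move=> /ereal_inf_lt[_ [a /= /cover_outer_eq0P h <-] ?]; exists a.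
Qed.

Lemma lt_pressure_at_scale d a : a%:E < pressure_at_scale Z f phi d ->
  exists N, 0 < cover_sum Z f phi a d N.
Proof.
move=> ap; apply: contrapT => /forallNP h; move: ap; apply/negP; rewrite -leNgt.
apply: ereal_inf_lbound; exists a => //=; apply/cover_outer_eq0P => N.
by apply/eqP; rewrite eq_le cover_sum_ge0 andbT leNgt; apply/negP/h.
Qed.

End pressure_scales.

(** The positive and the negative parts are compared separately, so that
    infinite integrals are covered. *)
Lemma le_integral_ae d (T : measurableType d) (R : realType)
    (mu : {measure set T -> \bar R}) (g h : T -> \bar R) :
  measurable_fun setT g -> measurable_fun setT h ->
  (\forall x \ae mu, (g x <= h x)%E) -> (\int[mu]_x g x <= \int[mu]_x h x)%E.
Proof.
move=> mg mh gh; rewrite integralE [leRHS]integralE.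
apply: leeB; apply: ae_ge0_le_integral => //;
  try exact: measurable_funepos; try exact: measurable_funeneg.
- apply: filterS gh => x gh _.
  by apply: (@funepos_le _ _ [set x]); rewrite ?inE// => y; rewrite inE => ->.
- apply: filterS gh => x gh _.
  by apply: (@funeneg_le _ _ [set x]); rewrite ?inE// => y; rewrite inE => ->.
Qed.

Section variational_principle.
Context {R : realType} {X : pointedMetricType R}.
Variables (f : naifs X) (phi : X -> R) (Z : set X).
Hypotheses (cptX : compact [set: X]) (cphi : continuous phi) (cptZ : compact Z).
Implicit Types (mu : probability (borel X) R).
Local Open Scope ereal_scope.

Lemma rate_geP mu n r x (s : R) : (0 < n)%N ->
  (s%:E <= rate f phi mu n r x) =
  (mu (bowen_ball f n x r) <= (bowen_weight f phi s (n, x))%:E).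
Proof.
move=> n0; rewrite /rate lee_pdivlMr ?ltr0n// -EFinM.
rewrite [RHS]leNgt /bowen_weight /= -expR_lt_lne ?measure_ge0// -leNgt.
case: (lne _) => [l| |] //=; rewrite ?lee_fin ?leey ?leNye//.
by rewrite mulNr; apply/idP/idP; lra.
Qed.

(** The mass distribution principle: a ball of a cover that meets [A] at [y] is
    contained in the ball of twice its radius centred at [y], whose measure is
    controlled by the hypothesis on [A]. *)
Lemma mass_distribution mu (A : set X) (a e s r : R) N :
  measurable (A : set (borel X)) -> mu Z = 1 ->
  (forall x y, mdist x y < r -> `|phi x - phi y| <= e)%R ->
  (a + e <= s)%R -> (0 < N)%N ->
  (forall x n, A x -> (N <= n)%N -> s%:E <= rate f phi mu n r x) ->
  mu A <= cover_sum Z f phi a (r / 2) N.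
Proof.
move=> mA muZ hphi aes N0 hA.
apply: le_ereal_inf_tmp => _ [D [n [x [Dn ZD ->]]]].
pose C i : set (borel X) :=
  if i \in D then A `&` bowen_ball f (n i) (x i) (r / 2) else set0.
have mB m y q : measurable (bowen_ball f m y q : set (borel X)).
  by apply: open_measurable_borel; exact: open_bowen_ball.
have mC i : measurable (C i).
  by rewrite /C; case: ifP => // _; exact: measurableI.
have mZ : measurable (Z : set (borel X)).
  rewrite -[Z]setCK; apply: measurableC; apply: open_measurable_borel.
  apply: closed_openC; apply: compact_closed => //; exact: metric_hausdorff.
have muAZ : mu A <= mu (A `&` Z).
  have muZC : mu (~` Z) = 0 by rewrite probability_setC// muZ subee.
  have mZC : measurable (~` Z : set (borel X)) by exact: measurableC.
  have mAZ : measurable (A `&` Z : set (borel X)) by exact: measurableI.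
  have mAZC : measurable (A `&` ~` Z : set (borel X)) by exact: measurableI.
  rewrite -[X in mu X <= _](setIT A) -(setUv Z) setIUr.
  apply: le_trans (measureU2 mu mAZ mAZC) _.
  rewrite [X in _ + X <= _](_ : _ = 0) ?adde0//.
  apply/eqP; rewrite eq_le measure_ge0 andbT -muZC.
  by apply: le_measure; rewrite ?inE.
apply: le_trans muAZ _.
apply: le_trans (_ : mu (\bigcup_i C i) <= _).
  apply: le_measure; rewrite ?inE;
    [exact: measurableI|exact: bigcup_measurable|].
  by move=> z [Az /ZD[i Di zi]]; exists i => //; rewrite /C mem_set.
apply: le_trans (le_mu_bigcup _ _ _) _ => //.
  exact: bigcup_measurable.
rewrite nneseries_esumT// [leRHS]esum_mkcond; apply: le_esum => i _.
rewrite /C; case: ifPn => iD; last by rewrite measure0.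
have Di : D i by exact: set_mem.
have [[y [Ay xy]]|/set0P/negP/negPn/eqP ->] :=
  pselect ((A `&` bowen_ball f (n i) (x i) (r / 2)) !=set0); last first.
  by rewrite measure0 lee_fin expR_ge0.
have r2 : (r = r / 2 + r / 2)%R by exact: splitr.
have n0 : (0 < n i)%N by exact: leq_trans N0 (Dn i Di).
have := hA y _ Ay (Dn i Di); rewrite rate_geP// => muy.
apply: le_trans (_ : mu (bowen_ball f (n i) y r) <= _).
  apply: le_measure; rewrite ?inE//; first exact: measurableI.
  move=> z [_ xz]; rewrite r2; exact: bowen_ballD (bowen_ball_sym xy) _ xz.
apply: le_trans muy _; rewrite lee_fin ler_expR /=.
have dr : (0 <= r / 2)%R.
  exact: le_trans (bowen_dist_ge0 f (n i) (x i) y) (ltW xy).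
have yx : (bowen_dist f (n i) y (x i) < r)%R.
  rewrite bowen_sym; apply: lt_le_trans xy _; lra.
have := max_sum_close hphi yx.
have : (0 <= (n i)%:R * (s - (a + e)))%R by rewrite mulr_ge0// subr_ge0.
lra.
Qed.

(** The exceptional set is a countable union of sets [A k N] on which a lower
    bound on the measure-theoretic rate holds uniformly. As covers at scale [1
    / (2 k + 2)] cost arbitrarily little, mass distribution makes them null. *)
Lemma lower_local_pressure_le_ae mu (s : R) : mu Z = 1 ->
  pressure Z f phi < s%:E ->
  \forall x \ae mu, lower_local_pressure mu f phi x <= s%:E.
Proof.
move=> muZ Ps.
have [a [Pa]] := lte_real_between Ps; rewrite lte_fin => as_.
pose e := (s - a)%R; have e0 : (0 < e)%R by rewrite subr_gt0.
have [r0 [r0_gt0 hphi]] := compact_unif_continuous cptX cphi e0.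
pose A k N := [set x |
  forall n, (N <= n)%N -> s%:E <= rate f phi mu n k.+1%:R^-1 x].
have mA k N : measurable (A k N : set (borel X)).
  rewrite (_ : A k N = \bigcap_(n in [set n | (N <= n)%N])
      ([set: borel X] `&` [set x | s%:E <= rate f phi mu n k.+1%:R^-1 x]));
    last first.
    apply/seteqP; split=> x /=; first by move=> h n Nn; split => //; exact: h.
    by move=> h n Nn; have [] := h n Nn.
  apply: bigcap_measurableType => n _.
  apply: emeasurable_fun_c_infty => //; exact: measurable_rate.
have A0 k N : (k.+1%:R^-1 < r0)%R -> mu.-negligible (A k N).
  move=> kr; exists (A k N); split => //; apply/eqP.
  rewrite eq_le measure_ge0 andbT.
  have k20 : (0 < k.+1%:R^-1 / 2 :> R)%R by rewrite divr_gt0.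
  have := le_lt_trans (pressure_at_scale_le f phi Z k20) Pa.
  move=> /pressure_at_scale_lt[b [ba /(_ N.+1) <-]].
  apply: (@mass_distribution mu _ b e s _ N.+1) => //.
  - by move=> x y xy; apply: hphi; exact: lt_trans kr.
  - by move: ba; rewrite lte_fin /e; lra.
  - by move=> x n Ax Nn; apply: Ax; exact: ltnW.
have [k0 _ hk0] := near_infty_natSinv_lt (PosNum r0_gt0).
suff : mu.-negligible
    (~` [set x | lower_local_pressure mu f phi x <= s%:E]) by [].
apply: (@negligibleS _ _ _ mu (\bigcup_k \bigcup_N A (k0 + k)%N N)); last first.
  apply: negligible_bigcup => k; apply: negligible_bigcup => N; apply: A0.
  by apply: hk0; exact: leq_addr.
move=> x /= /negP; rewrite -ltNge lower_local_pressureE.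
move=> /ereal_sup_gt[_ [r /= r_gt0 <-] sr].
have [k _ hk] := near_infty_natSinv_lt (PosNum r_gt0).
have : s%:E < limn_einf (fun n => rate f phi mu n (k0 + k).+1%:R^-1 x).
  apply: lt_le_trans sr _; apply: le_limn_einf => n; apply: le_rate.
  by apply/ltW/(hk (k0 + k)%N); exact: leq_addl.
by move=> /limn_einf_gt[N hN]; exists k => //; exists N.
Qed.

Lemma lower_measure_pressure_le mu : mu Z = 1 ->
  lower_measure_pressure mu f phi <= pressure Z f phi.
Proof.
move=> muZ; rewrite leNgt; apply/negP => Plt.
have [s [Ps sm]] := lte_real_between Plt.
move: sm; apply/negP; rewrite -leNgt.
rewrite -[leRHS]mule1 -(probability_setT mu) -integral_cst//.
apply: le_integral_ae;
  [exact: measurable_lower_local_pressure|exact: measurable_cst|].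
exact: lower_local_pressure_le_ae.
Qed.

(** The three [e] of room between [s] and the pressure pay for the two losses
    in [cover_sum_le_cost] and for the constant [1 / c] in [frostman], which is
    at most [exp(e n)] for large [n]. *)
Lemma exists_measure_pressure_ge (s : R) : s%:E < pressure Z f phi ->
  exists mu, mu Z = 1 /\ s%:E <= lower_measure_pressure mu f phi.
Proof.
rewrite pressureE => /ereal_sup_gt[_ [q /= q0 <-] sq].
have [s' [ss' s'q]] := lte_real_between sq; rewrite lte_fin in ss'.
pose e := ((s' - s) / 3)%R; have e0 : (0 < e)%R by rewrite divr_gt0// subr_gt0.
have s'E : s' = (s + e + e + e)%R by rewrite /e; field.
rewrite s'E in s'q.
have [d0 [d0_gt0 hphi]] := compact_unif_continuous cptX cphi e0.
pose d := Num.min d0 (q / 2)%R.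
have d_gt0 : (0 < d)%R by rewrite lt_min d0_gt0 divr_gt0.
have dq : (d + d <= q)%R.
  have : (d <= q / 2)%R by rewrite ge_min lexx orbT.
  lra.
have [N0 N0_gt0] := lt_pressure_at_scale
  (lt_le_trans s'q (le_pressure_at_scale f phi Z dq)).
have [N1 hN1] := geometric_tail e0.
(* The successor makes the level positive, as dividing by it requires. *)
pose N := (maxn N0 N1).+1.
have cov0 : 0 < cover_sum Z f phi (s + e + e + e) (d + d) N.
  apply: lt_le_trans N0_gt0 _; apply: le_cover_sum_level.
  by rewrite leqW// leq_maxl.
have [c [c0 cP]] : exists c : R, (0 < c)%R /\
    c%:E <= cover_sum Z f phi (s + e + e + e) (d + d) N.
  move: cov0; case: (cover_sum _ _ _ _ _ _) => [c||]//.
    by rewrite lte_fin => c0; exists c.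
  by move=> _; exists 1%R; rewrite leey.
have [|mu [muZ muB]] := @frostman _ _ f phi Z (s + e) d N d_gt0 cptZ c cptX c0.
  move=> F FN FZ; rewrite -lee_fin; apply: le_trans cP _.
  apply: cover_sum_le_cost => //.
    move=> x y xy; apply: hphi; apply: lt_le_trans xy _.
    by rewrite ge_min lexx.
  by move=> M; apply: hN1; rewrite leqW// leq_maxr.
exists mu; split => //.
have local x : s%:E <= lower_local_pressure mu f phi x.
  rewrite lower_local_pressureE.
  apply: le_trans (_ : limn_einf (fun n => rate f phi mu n d x) <= _);
    last first.
    by apply: ereal_sup_ubound; exists d.
  have [K Kc] : exists K : nat, (- ln c <= e * K%:R)%R.
    exists (Num.truncn (- ln c / e)).+1.
    by rewrite mulrC -ler_pdivrMr//; exact/ltW/truncnS_gt.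
  apply: (@limn_einf_ge _ _ _ (maxn N K)) => n; rewrite geq_max => /andP[Nn Kn].
  rewrite rate_geP; last exact: leq_trans Nn.
  apply: le_trans (muB n x Nn) _; rewrite lee_fin.
  rewrite ler_pdivrMr// -[X in (_ * X)%R]lnK ?posrE// -expRD ler_expR /=.
  have : (e * K%:R <= e * n%:R)%R by rewrite ler_pM2l// ler_nat.
  lra.
rewrite -[leLHS]mule1 -(probability_setT mu) -integral_cst//.
apply: le_integral_ae;
  [exact: measurable_cst|exact: measurable_lower_local_pressure|].
exact: aeW.
Qed.

End variational_principle.

Unset Implicit Arguments.

Theorem theorem4p8 (R : realType) (X : pointedMetricType R)
    (cptX : compact [set: X]) (f : naifs X)
    (phi : X -> R) (cont_phi : continuous phi)
    (Z : set X) (Z_neq0 : Z !=set0) (cptZ : compact Z) :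
  pressure Z f phi =
  ereal_sup [set lower_measure_pressure mu f phi |
              mu in [set mu : probability (borel X) R | mu Z = 1%E]].
Proof.
apply/eqP; rewrite eq_le; apply/andP; split; last first.
  by apply: ge_ereal_sup => _ [mu /= muZ <-]; exact: lower_measure_pressure_le.
rewrite leNgt; apply/negP => ltP.
have [s [sm sP]] := lte_real_between ltP.
have [mu [muZ smu]] := exists_measure_pressure_ge cptX cont_phi cptZ sP.
move: sm; apply/negP; rewrite -leNgt; apply: le_trans smu _.
by apply: ereal_sup_ubound; exists mu.
Qed.
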